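(* Let $L$ be a finite triangular semimodular lattice. Then the chain polynomial $c_L$ of $L$ is real-rooted, and all of its zeros lie in the interval $[-1,0]$.
   Context: The chain polynomial of a finite poset $P$ is $c_P=\sum_{k\ge 0} c_k(P)t^k$, where $c_k(P)$ is the number of $k$-element chains (totally ordered subsets) of $P$ (so $c_0(P)=1$). A polynomial in $\mathbb{R}[t]$ is real-rooted if all of its zeros are real. A locally finite lattice $L$ is semimodular if it is graded and its rank function $\rho$ satisfies $\rho(x)+\rho(y)\ge \rho(x\wedge y)+\rho(x\vee y)$ for all $x,y\in L$. Let $P$ be a locally finite poset with a least element $\hat 0$ such that each finite interval in $P$ is graded, with rank function $\rho$. Then $P$ is triangular if there is a function $M:\{(i,j)\in\mathbb{N}\times\mathbb{N}: i<j\}\to\mathbb{N}$ such that any interval $[x,y]$ of $P$ with $\rho(x)=i$ and $\rho(y)=j$ (where $i<j$) has exactly $M(i,j)$ maximal chains. *)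

(* Defs.v *)
From HB Require Import structures.
From mathcomp Require Import all_boot all_order all_algebra.
From mathcomp Require Import complex reals.

Set Implicit Arguments.
Unset Strict Implicit.
Unset Printing Implicit Defensive.

Import Order.TTheory GRing.Theory Num.Theory.

Section Chains.
Context {d : Order.disp_t} {P : finPOrderType d}.

Definition is_chain (C : {set P}) : bool :=
  [forall x in C, forall y in C, (x >=< y)%O].

(* Maximal chains are compared by number of elements; the length of a chain C
   is #|C|.-1. *)
Definition max_chain_in (A C : {set P}) : bool :=
  maxset (fun D : {set P} => (D \subset A) && is_chain D) C.

Definition graded (A : {set P}) : Prop :=
  forall C D : {set P}, max_chain_in A C -> max_chain_in A D -> #|C| = #|D|.

Definition closed_itv (x y : P) : {set P} := [set z | (x <= z <= y)%O].

Definition num_max_chains (x y : P) : nat :=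
  #|[set C : {set P} | max_chain_in (closed_itv x y) C]|.

Definition num_chains (k : nat) : nat :=
  #|[set C : {set P} | is_chain C && (#|C| == k)]|.

End Chains.

(* No chain of P has more than #|P| elements, so the sum over all k stops at
   k = #|P|. *)
Definition chain_polynomial (R : nzRingType) {d : Order.disp_t}
    (P : finPOrderType d) : {poly R} :=
  (\sum_(k < #|P|.+1) (num_chains (P := P) k)%:R *: 'X^k)%R.

(* The common length of the maximal chains of [\bot, x] whenever this interval
   is graded; the maximum only serves to make the function total. *)
Definition rank {d : Order.disp_t} {P : finBPOrderType d} (x : P) : nat :=
  \max_(C : {set P} | max_chain_in (closed_itv \bot%O x) C) #|C|.-1.

Definition semimodular {d : Order.disp_t} (L : finTBLatticeType d) : Prop :=
  graded [set: L] /\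
  forall x y : L, rank (x `&` y)%O + rank (x `|` y)%O <= rank x + rank y.

(* M is total on pairs, but only its values at i < j are constrained. *)
Definition triangular {d : Order.disp_t} (P : finBPOrderType d) : Prop :=
  (forall x y : P, (x <= y)%O -> graded (closed_itv x y)) /\
  exists M : nat -> nat -> nat,
    forall (i j : nat) (x y : P), i < j -> (x <= y)%O ->
      rank x = i -> rank y = j -> num_max_chains x y = M i j.

Definition real_rooted (R : realType) (p : {poly R}) : Prop :=
  forall z : R[i]%C, root (map_poly (real_complex R) p) z ->
    exists x : R, z = (x%:C)%C.

(* Main.v *)
Require Import Defs.
From mathcomp Require Import all_boot all_order all_algebra.
From mathcomp Require Import complex reals.
From mathcomp Require Import zify ring lra.

(** For [t] in a commutative ring, give an element [x] of [L] the weight [W x],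
    the sum of [t ^+ #|C|] over the chains [C] with least element [\bot] and
    greatest element [x], and let [J u x] be the sum of the weights of the [y]
    whose join with [u] is [x].

    Triangularity makes the number of elements of given rank in an interval
    depend on the ranks of its ends only: cutting maximal chains at rank [k]
    shows that [[x, y]] has [M i j / (M i k * M k j)] elements of rank [k]. So
    [W x] depends only on the rank of [x], and, by inclusion-exclusion,
    [J u x] depends only on the ranks of [u] and [x] ([join_weight_rank]).

    If [v] covers [u] and [y] is an element below [x] with join [x] with [v]
    but not with [u], then by semimodularity the join [z] of [y] and [u] is a
    coatom of [[u, x]] not above [v]. Hence [J v x] is [J u x] plus the sum of
    [J u z] over such coatoms ([join_weight_step]). Along a maximal chain
    [X 0 < ... < X N] of [L], the values [f n j = J (X j) (X n)] thus satisfy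
    [f n.+1 j.+1 = f n.+1 j + f n j *+ lambda n j] with natural numbers
    [lambda n j]. Removing the top of a chain gives
    [t * f n n = (1 + t) * f n 0] for [n > 0], and pairing the chains with and
    without [\bot] gives [t * c_L(t) = (1 + t) * f N N] ([chain_array]).
    Together, the first two relations express a row by the previous one:
    [f n.+1 j] is [1 + t] times the sum of the [f n k *+ lambda n k] with
    [k < j], plus [t] times the sum of those with [k >= j].

    It remains to see that [f N N] does not vanish at a point [t] outside
    [[-1, 0]]. If [t] is real, then [1 + t] and [t] have the same sign and all
    entries of a row have the same strict sign ([array_diag_neq0_real]). If [t]
    lies in the upper half-plane, so does [x = t / (1 + t)], and the row
    operation preserves the following property: the entries of the row are
    nonzero, their directions turn clockwise as [j] grows, and they turn by no
    more than the argument of [x] (definition [fan], lemma [fan_step]). As a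
    statement on polynomials in [t], this says that the entries of a row
    interlace; read at a single point, it reduces to identities between real
    bilinear forms in the plane. *)

Set Implicit Arguments.
Unset Strict Implicit.
Unset Printing Implicit Defensive.

Import Order.TTheory GRing.Theory Num.Theory.

(** * Maximal chains of an interval, cut at one of their elements *)

Section MaximalChains.
Context {d : Order.disp_t} {P : finPOrderType d}.
Implicit Types (x y z : P) (A C D E : {set P}).

Lemma is_chainP C :
  reflect {in C &, forall x y, (x >=< y)%O} (is_chain C).
Proof.
apply: (iffP forall_inP) => [H x y xC yC|H x xC].
  by have /forall_inP/(_ y yC) := H x xC.
by apply/forall_inP=> y yC; apply: H.
Qed.

Lemma is_chainS C D : C \subset D -> is_chain D -> is_chain C.
Proof.
move=> /subsetP sCD /is_chainP H; apply/is_chainP=> x y xC yC.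
by apply: H; apply: sCD.
Qed.

Lemma is_chainU1 x C :
  is_chain C -> {in C, forall c, (x >=< c)%O} -> is_chain (x |: C).
Proof.
move=> /is_chainP H Hx; apply/is_chainP=> a b.
move=> /setU1P[->|aC] /setU1P[->|bC].
- exact: comparablexx.
- exact: Hx.
- by rewrite comparable_sym; apply: Hx.
- exact: H.
Qed.

(** Adding a compatible element to a chain gives a chain, so maximality can be
    tested on single elements. *)
Lemma max_chain_inP A C :
  reflect [/\ C \subset A, is_chain C
            & forall e, e \in A -> {in C, forall c, (e >=< c)%O} -> e \in C]
          (max_chain_in A C).
Proof.
apply: (iffP maxsetP) => [[/andP[sCA cC] H]|[sCA cC H]].
  split=> // e eA ec; rewrite -(H (e |: C)) ?setU11 ?subsetUr //.
  by rewrite subUset sub1set eA sCA is_chainU1.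
split=> [|D /andP[/subsetP sDA /is_chainP cD] sCD]; first by rewrite sCA.
apply/eqP; rewrite eqEsubset sCD andbT; apply/subsetP=> e eD.
by apply: H => [|c cC']; [exact: sDA | apply: cD => //; apply: (subsetP sCD)].
Qed.

Lemma max_chain_exists A : exists C, max_chain_in A C.
Proof.
have [|C HC _] := @maxset_exists _
  (fun D : {set P} => (D \subset A) && is_chain D) set0.
  by rewrite sub0set; apply/is_chainP=> x y; rewrite inE.
by exists C.
Qed.

Lemma max_chain_ends x y C : (x <= y)%O -> max_chain_in (closed_itv x y) C ->
  (x \in C) && (y \in C).
Proof.
move=> xy /max_chain_inP[/subsetP sC _ H].
apply/andP; split; apply: H; rewrite ?inE ?lexx ?xy // => c /sC;
  rewrite inE => /andP[xc cy].
  exact: le_comparable.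
exact: ge_comparable.
Qed.

Lemma closed_itvxx x : closed_itv x x = [set x].
Proof. by apply/setP=> z; rewrite !inE andbC -eq_le. Qed.

Lemma max_chain_glue x z y D E : (x <= z)%O -> (z <= y)%O ->
  max_chain_in (closed_itv x z) D -> max_chain_in (closed_itv z y) E ->
  max_chain_in (closed_itv x y) (D :|: E).
Proof.
move=> xz zy HD HE.
have /andP[_ zD] := max_chain_ends xz HD.
move: HD HE => /max_chain_inP[/subsetP sD cD mD].
move=> /max_chain_inP[/subsetP sE cE mE].
have lD a : a \in D -> (x <= a <= z)%O by move/sD; rewrite inE.
have lE a : a \in E -> (z <= a <= y)%O by move/sE; rewrite inE.
apply/max_chain_inP; split.
- apply/subsetP=> a /setUP[/lD /andP[xa az]|/lE /andP[za ay]]; rewrite inE.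
    by rewrite xa (le_trans az).
  by rewrite ay (le_trans xz).
- apply/is_chainP=> a b /setUP[aD|aE] /setUP[bD|bE].
  + exact: (is_chainP _ cD).
  + apply: le_comparable; have /andP[_ az] := lD _ aD.
    by have /andP[zb _] := lE _ bE; apply: le_trans zb.
  + apply: ge_comparable; have /andP[_ bz] := lD _ bD.
    by have /andP[za _] := lE _ aE; apply: le_trans za.
  + exact: (is_chainP _ cE).
- move=> e; rewrite inE => /andP[xe ey] ec.
  have: (e >=< z)%O by apply: ec; rewrite inE zD.
  rewrite inE; case/orP=> h; apply/orP; [left; apply: mD|right; apply: mE];
    rewrite ?inE ?h ?xe ?ey // => c cC; apply: ec; rewrite inE cC ?orbT //.
Qed.

Lemma max_chain_lower x y z C : z \in C ->
  max_chain_in (closed_itv x y) C ->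
  max_chain_in (closed_itv x z) (C :&: closed_itv x z).
Proof.
move=> zC /max_chain_inP[/subsetP sC cC mC].
have: z \in closed_itv x y by apply: sC.
rewrite inE => /andP[xz zy].
apply/max_chain_inP; split; first exact: subsetIr.
  by apply: is_chainS cC; apply: subsetIl.
move=> e eI ec; rewrite inE eI andbT; move: eI; rewrite inE => /andP[xe ez].
apply: mC => [|c cC']; first by rewrite inE xe (le_trans ez).
have := sC _ cC'; rewrite inE => /andP[xc cy].
case/orP: (is_chainP _ cC _ _ cC' zC) => h.
  by apply: ec; rewrite !inE cC' xc.
by apply: le_comparable; apply: le_trans h.
Qed.

Lemma max_chain_upper x y z C : z \in C ->
  max_chain_in (closed_itv x y) C ->
  max_chain_in (closed_itv z y) (C :&: closed_itv z y).
Proof.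
move=> zC /max_chain_inP[/subsetP sC cC mC].
have: z \in closed_itv x y by apply: sC.
rewrite inE => /andP[xz zy].
apply/max_chain_inP; split; first exact: subsetIr.
  by apply: is_chainS cC; apply: subsetIl.
move=> e eI ec; rewrite inE eI andbT; move: eI; rewrite inE => /andP[ze ey].
apply: mC => [|c cC']; first by rewrite inE ey (le_trans xz).
have := sC _ cC'; rewrite inE => /andP[xc cy].
case/orP: (is_chainP _ cC _ _ cC' zC) => h.
  by apply: ge_comparable; apply: le_trans h ze.
by apply: ec; rewrite !inE cC' h.
Qed.

Lemma max_chain_cut x y z C : z \in C ->
  max_chain_in (closed_itv x y) C ->
  (C :&: closed_itv x z) :|: (C :&: closed_itv z y) = C.
Proof.
move=> zC /max_chain_inP[/subsetP sC cC _].
rewrite -setIUr; apply/setIidPl/subsetP=> c cC'.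
have := sC _ cC'; rewrite !inE => /andP[-> ->]; rewrite andbT /=.
exact: (is_chainP _ cC).
Qed.

Lemma itv_glueI x y z D E :
  D \subset closed_itv x z -> E \subset closed_itv z y ->
  z \in D -> z \in E ->
  ((D :|: E) :&: closed_itv x z = D) * ((D :|: E) :&: closed_itv z y = E)
  * (D :&: E = [set z]).
Proof.
move=> /subsetP sD /subsetP sE zD zE.
have lD a : a \in D -> (x <= a <= z)%O by move/sD; rewrite inE.
have lE a : a \in E -> (z <= a <= y)%O by move/sE; rewrite inE.
split; [split|]; apply/setP=> a; rewrite !inE.
- apply/andP/idP => [[/orP[//|/lE/andP[za _]] /andP[_ az]]|aD].
    by have -> : a = z by apply/eqP; rewrite eq_le az za.
  by rewrite aD lD.
- apply/andP/idP => [[/orP[/lD/andP[_ az]|//] /andP[za _]]|aE].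
    by have -> : a = z by apply/eqP; rewrite eq_le az za.
  by rewrite aE orbT lE.
- apply/andP/eqP => [[/lD/andP[_ az] /lE/andP[za _]]|->]; last by rewrite zD zE.
  by apply/eqP; rewrite eq_le az za.
Qed.

Lemma card_glue x y z D E : (x <= z)%O -> (z <= y)%O ->
  max_chain_in (closed_itv x z) D -> max_chain_in (closed_itv z y) E ->
  #|D :|: E| = #|D| + #|E|.-1.
Proof.
move=> xz zy HD HE.
have /andP[_ zD] := max_chain_ends xz HD.
have /andP[zE _] := max_chain_ends zy HE.
move: HD HE => /max_chain_inP[sD _ _] /max_chain_inP[sE _ _].
rewrite cardsU (itv_glueI sD sE zD zE) cards1.
by move: zE; rewrite (cardD1 z E) => ->; rewrite addnA addn1 subn1.
Qed.

(** The maximal chains of [[x, y]] through [z] are the unions of a maximal chain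
    of [[x, z]] and one of [[z, y]], and the two parts can be recovered by
    intersecting with these intervals. *)
Lemma card_max_chains_through x y z : (x <= z)%O -> (z <= y)%O ->
  #|[set C : {set P} | max_chain_in (closed_itv x y) C & z \in C]|
    = num_max_chains x z * num_max_chains z y.
Proof.
move=> xz zy; rewrite /num_max_chains -cardsX.
set X := setX _ _.
have XP p : p \in X -> max_chain_in (closed_itv x z) p.1 /\
  max_chain_in (closed_itv z y) p.2 by rewrite !inE => /andP.
have <- : [set p.1 :|: p.2 | p in X] = 
  [set C : {set P} | max_chain_in (closed_itv x y) C & z \in C].
  apply/setP=> C; rewrite inE; apply/imsetP/andP => [[[D E] /XP[/= HD HE] ->]|].
    rewrite inE; have /andP[_ ->] := max_chain_ends xz HD.
    by split; first exact: (max_chain_glue xz zy).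
  case=> HC zC; exists (C :&: closed_itv x z, C :&: closed_itv z y).
    by rewrite !inE /= (max_chain_lower zC HC) (max_chain_upper zC HC).
  by rewrite /= max_chain_cut.
apply: card_in_imset => -[D E] [D' E'] /XP[/= HD HE] /XP[/= HD' HE'] eqDE.
have /andP[_ zD] := max_chain_ends xz HD.
have /andP[zE _] := max_chain_ends zy HE.
have /andP[_ zD'] := max_chain_ends xz HD'.
have /andP[zE' _] := max_chain_ends zy HE'.
move: HD HE HD' HE' => /max_chain_inP[sD _ _] /max_chain_inP[sE _ _]
  /max_chain_inP[sD' _ _] /max_chain_inP[sE' _ _].
have [[eD eE] _] := itv_glueI sD sE zD zE.
have [[eD' eE'] _] := itv_glueI sD' sE' zD' zE'.
by congr pair; [rewrite -eD eqDE eD' | rewrite -eE eqDE eE'].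
Qed.

End MaximalChains.

(** * Ranks *)

Section Rank.
Context {d : Order.disp_t} {P : finBPOrderType d}.
Hypothesis gr : forall x y : P, (x <= y)%O -> graded (closed_itv x y).
Implicit Types (x y z : P) (C : {set P}).

Lemma rankE x C : max_chain_in (closed_itv \bot%O x) C -> rank x = #|C|.-1.
Proof.
move=> HC; apply/eqP; rewrite eqn_leq; apply/andP; split.
  apply/bigmax_leqP=> D HD.
  by rewrite (gr (le0x x) HD HC).
by rewrite /rank; exact: (bigop.bigmax_sup C).
Qed.

Lemma rank_bot : rank (\bot%O : P) = 0.
Proof.
apply/eqP; rewrite -leqn0; apply/bigmax_leqP=> C /max_chain_inP[+ _ _].
rewrite closed_itvxx => /subset_leq_card.
by rewrite cards1; case: #|C| => [|[]].
Qed.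

Lemma rank_max_chain x y C : (x <= y)%O ->
  max_chain_in (closed_itv x y) C -> rank y = rank x + #|C|.-1.
Proof.
move=> xy HC; have [D HD] := max_chain_exists (closed_itv \bot%O x).
rewrite (rankE HD) (rankE (max_chain_glue (le0x x) xy HD HC)).
rewrite (card_glue (le0x x) xy HD HC).
have /andP[_ xD] := max_chain_ends (le0x x) HD.
by rewrite (cardD1 x) xD.
Qed.

Lemma rank_lt x y : (x < y)%O -> rank x < rank y.
Proof.
move=> lxy; have xy := ltW lxy.
have [C HC] := max_chain_exists (closed_itv x y).
rewrite (rank_max_chain xy HC) -[X in X < _]addn0 ltn_add2l.
have /andP[xC yC] := max_chain_ends xy HC.
by rewrite (cardD1 x) xC (cardD1 y) !inE yC gt_eqF.
Qed.

Lemma rank_le x y : (x <= y)%O -> rank x <= rank y.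
Proof. by rewrite le_eqVlt => /orP[/eqP->//|/rank_lt/ltnW]. Qed.

Lemma eq_rank x y : (x <= y)%O -> rank x = rank y -> x = y.
Proof.
by rewrite le_eqVlt => /orP[/eqP//|/rank_lt h] e; rewrite e ltnn in h.
Qed.

Lemma rank_chain_inj C : is_chain C -> {in C &, injective (@rank _ P)}.
Proof.
move=> /is_chainP cC a b aC bC e.
by case/orP: (cC _ _ aC bC) => h; [|symmetry]; apply: eq_rank.
Qed.

(** Ranks are injective on a maximal chain of [[x, y]], and there are just
    enough of its elements to take every value between [rank x] and [rank y]. *)
Lemma max_chain_rank x y C k : (x <= y)%O ->
  max_chain_in (closed_itv x y) C -> rank x <= k <= rank y ->
  exists2 z, z \in C & rank z = k.
Proof.
move=> xy HC /andP[xk ky].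
have ry := rank_max_chain xy HC.
have /andP[xC yC] := max_chain_ends xy HC.
have C0 : 0 < #|C| by rewrite (cardD1 x) xC.
case/max_chain_inP: HC => /subsetP sC cC _.
pose h (z : P) : 'I_(rank y - rank x).+1 := inord (rank z - rank x).
have hE z : z \in C -> h z = rank z - rank x :> nat /\ rank x <= rank z.
  move/sC; rewrite inE => /andP[xz zy]; split; last exact: rank_le.
  by rewrite /h inordK // ltnS leq_sub2r // rank_le.
have inj : {in C &, injective h}.
  move=> a b aC bC /(congr1 (@nat_of_ord _)).
  have [-> la] := hE _ aC; have [-> lb] := hE _ bC.
  move=> /(congr1 (addn^~ (rank x))); rewrite !subnK // => e.
  exact: (rank_chain_inj cC).
have full : h @: C = setT.
  apply/eqP; rewrite eqEcard subsetT cardsT card_ord (card_in_imset inj) ry.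
  by rewrite addKn prednK /=.
have : inord (k - rank x) \in h @: C by rewrite full inE.
case/imsetP=> z zC /(congr1 (@nat_of_ord _)).
rewrite inordK ?ltnS ?leq_sub2r //; have [-> lz] := hE _ zC.
move=> /(congr1 (addn^~ (rank x))); rewrite !subnK // => e.
by exists z.
Qed.

(** Every maximal chain of [[x, y]] meets the rank [k] exactly once; sort the
    chains by this element. *)
Lemma sum_num_max_chains x y k : (x <= y)%O -> rank x <= k <= rank y ->
  \sum_(z | (x <= z <= y)%O && (rank z == k))
     num_max_chains x z * num_max_chains z y = num_max_chains x y.
Proof.
move=> xy kb.
rewrite (eq_bigr (fun z =>
  \sum_(C | max_chain_in (closed_itv x y) C && (z \in C)) 1)).
  rewrite (exchange_big_dep (max_chain_in (closed_itv x y))) /=; last first.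
    by move=> z C _ /andP[].
  rewrite /num_max_chains -sum1dep_card; apply: eq_bigr => C HC.
  have [z zC rz] := max_chain_rank xy HC kb.
  rewrite (big_pred1 z) // => z'; rewrite HC /=.
  have [/subsetP sC cC _] := max_chain_inP _ _ HC.
  apply/andP/eqP => [[/andP[_ /eqP rz'] z'C]|->].
    by apply: (rank_chain_inj cC) => //; rewrite rz.
  by have := sC _ zC; rewrite inE => ->; rewrite rz eqxx.
move=> z /andP[/andP[xz zy] _].
by rewrite -card_max_chains_through // -sum1dep_card.
Qed.

Lemma num_max_chains_gt0 x y : 0 < num_max_chains x y.
Proof.
have [C HC] := max_chain_exists (closed_itv x y).
by apply/card_gt0P; exists C; rewrite inE.
Qed.

Lemma num_max_chains_refl x : num_max_chains x x = 1.
Proof.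
rewrite /num_max_chains closed_itvxx -(cards1 [set x]).
apply: eq_card => C; rewrite !inE.
apply/idP/eqP => [HC|->].
  have /andP[xC _] : (x \in C) && (x \in C).
    by apply: max_chain_ends; rewrite ?lexx ?closed_itvxx.
  case/max_chain_inP: HC => sC _ _; apply/eqP.
  by rewrite eqEsubset sC sub1set.
apply/max_chain_inP; split=> //.
by apply/is_chainP=> a b /set1P-> /set1P->; apply: comparablexx.
Qed.

End Rank.

(** * Counting by ranks in triangular posets *)

Section Triangular.
Context {d : Order.disp_t} {P : finBPOrderType d}.
Hypothesis tri : triangular P.
Implicit Types x y u z : P.

Let gr := tri.1.

Lemma num_max_chains_rank x y x' y' : (x <= y)%O -> (x' <= y')%O ->
  rank x = rank x' -> rank y = rank y' ->
  num_max_chains x y = num_max_chains x' y'.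
Proof.
case: tri => _ [M HM] xy xy' ex ey.
have := rank_le gr xy; rewrite leq_eqVlt => /orP[/eqP e|lt].
  rewrite -(eq_rank gr xy e) -(eq_rank gr xy') -?ex -?ey //.
  by rewrite !num_max_chains_refl.
by rewrite (HM _ _ _ _ lt xy) // (HM _ _ _ _ lt xy').
Qed.

(** All terms of [sum_num_max_chains] have the same positive value, determined
    by the three ranks, so the number of terms is determined by the ranks. *)
Lemma card_rank x y x' y' k : (x <= y)%O -> (x' <= y')%O ->
  rank x = rank x' -> rank y = rank y' ->
  #|[pred z | (x <= z <= y)%O & rank z == k]|
  = #|[pred z | (x' <= z <= y')%O & rank z == k]|.
Proof.
move=> xy xy' ex ey.
have [kb|kb] := boolP (rank x <= k <= rank y); last first.
  have out u v : rank u = rank x -> rank v = rank y ->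
      [pred z | (u <= z <= v)%O & rank z == k] =1 pred0.
    move=> eu ev z /=; apply: contraNF kb.
    by rewrite -eu -ev; case/andP=> /andP[uz zv] /eqP <-; rewrite !(rank_le gr).
  by rewrite (eq_card0 (out x y _ _)) // (eq_card0 (out x' y' _ _)).
have [C HC] := max_chain_exists (closed_itv x y).
have [z0 zC r0] := max_chain_rank gr xy HC kb.
case/max_chain_inP: HC => /subsetP/(_ _ zC) + _ _.
rewrite inE => /andP[xz0 z0y].
have := num_max_chains_rank xy xy' ex ey.
have kb' : rank x' <= k <= rank y' by rewrite -ex -ey.
rewrite -(sum_num_max_chains gr xy kb) -(sum_num_max_chains gr xy' kb').
set a := num_max_chains x z0 * num_max_chains z0 y.
rewrite (eq_bigr (fun => a)); last first.
  move=> z /andP[/andP[xz zy] /eqP rz].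
  by congr muln; apply: num_max_chains_rank; rewrite ?rz ?r0.
rewrite [RHS](eq_bigr (fun => a)); last first.
  move=> z /andP[/andP[xz zy] /eqP rz].
  by congr muln; apply: num_max_chains_rank; rewrite ?rz ?r0.
rewrite !sum_nat_const => /eqP; rewrite eqn_pmul2r => [/eqP //|].
by rewrite muln_gt0 !num_max_chains_gt0.
Qed.

(** The form in which [card_rank] is used: rank-invariant quantities are stable
    under summation over the elements of an interval whose rank is restricted
    by [Q]. *)
Lemma sum_rank (V : nmodType) (Q : pred nat) (h h' : P -> V) x y x' y' :
  (x <= y)%O -> (x' <= y')%O -> rank x = rank x' -> rank y = rank y' ->
  (forall z z', (x <= z <= y)%O -> (x' <= z' <= y')%O ->
     rank z = rank z' -> Q (rank z) -> h z = h' z') ->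
  (\sum_(z | (x <= z <= y)%O && Q (rank z)) h z
  = \sum_(z | (x' <= z <= y')%O && Q (rank z)) h' z)%R.
Proof.
move=> xy xy' ex ey hh.
pose K := (rank y).+1.
have lK z : (x <= z <= y)%O -> rank z < K.
  by case/andP=> _ /(rank_le gr).
have lK' z : (x' <= z <= y')%O -> rank z < K.
  by case/andP=> _ /(rank_le gr); rewrite -ey.
rewrite (partition_big (fun z => inord (rank z) : 'I_K) predT) //.
rewrite [RHS](partition_big (fun z => inord (rank z) : 'I_K) predT) //.
apply: eq_bigr => k _.
have E (Z : pred P) : (forall z, Z z -> rank z < K) ->
  [pred z | Z z && Q (rank z) & (inord (rank z) == k)] =1
  [pred z | Q k && (Z z && (rank z == k))].
  move=> ZK z /=; apply/idP/idP.
    case/andP=> /andP[Zz Qz] /eqP e; have := ZK _ Zz => zK.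
    by rewrite Zz -e inordK // Qz eqxx.
  by case/and3P=> Qk -> /eqP e; rewrite e Qk inord_val eqxx.
rewrite (eq_bigl _ _ (E _ lK)) [RHS](eq_bigl _ _ (E _ lK')) /=.
case Qk: (Q k); last by rewrite !big1.
have := card_rank k xy xy' ex ey.
set p := [pred z | _ & _]; set p' := [pred z | _ & _] => cp.
have [z0 z0p|p0] := pickP p; last first.
  have p0' : p' =1 xpred0.
    have c0 : #|p'| = 0 by rewrite -cp; apply: eq_card0.
    by move=> z; apply: (card0_eq c0 z).
  by rewrite !big_pred0.
have pE z : p z -> (x <= z <= y)%O /\ rank z = k.
  by case/andP=> ? /eqP.
have pE' z : p' z -> (x' <= z <= y')%O /\ rank z = k.
  by case/andP=> ? /eqP.
have [z0' z0p'] : exists z, p' z.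
  have : 0 < #|p'| by rewrite -cp; apply/card_gt0P; exists z0.
  by case/card_gt0P=> z; exists z.
have [i0 r0] := pE _ z0p; have [i0' r0'] := pE' _ z0p'.
rewrite (eq_bigr (fun => h z0)) => [|z /pE[iz rz]]; last first.
  by rewrite (hh z z0') ?rz // -(hh z0 z0') ?r0.
rewrite [RHS](eq_bigr (fun => h z0)) => [|z /pE'[iz rz]]; last first.
  by rewrite -(hh z0 z) ?rz ?r0.
by rewrite !sumr_const cp.
Qed.

End Triangular.

(** * Weights of chains *)

Section ChainWeights.
Context {d : Order.disp_t} {P : finBPOrderType d}.
Context {F : comNzRingType} (t : F).
Implicit Types (x y z : P) (C : {set P}).
Local Open Scope ring_scope.

Definition chain_to x C :=
  [&& is_chain C, \bot%O \in C, x \in C & [forall y in C, (y <= x)%O]].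

Definition chain_weight x : F := \sum_(C | chain_to x C) t ^+ #|C|.

Lemma chain_max C : is_chain C -> C != set0 ->
  exists2 m, m \in C & {in C, forall c, (c <= m)%O}.
Proof.
move=> /is_chainP cC /set0Pn[x xC].
have [m mC max_m] :=
  @arg_maxnP _ x (mem C) (fun m => #|[set y | (y <= m)%O]|) xC.
exists m => // c cC'; case/orP: (cC _ _ cC' mC) => // mc.
rewrite le_eqVlt; apply/orP; left; rewrite eq_le [X in _ && X]mc andbT.
have: [set y | (y <= m)%O] == [set y | (y <= c)%O].
  rewrite eqEcard; apply/andP; split; last exact: max_m.
  by apply/subsetP=> y; rewrite !inE => ym; apply: le_trans mc.
by move/eqP/setP/(_ c); rewrite !inE lexx.
Qed.

(** Sort the chains inside the down-set [Q] by their greatest element. *)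
Lemma sum_chain_weight (Q : pred P) :
  (forall x y, (x <= y)%O -> Q y -> Q x) ->
  \sum_(x | Q x) chain_weight x
  = \sum_(C | [&& is_chain C, \bot%O \in C & C \subset Q]) t ^+ #|C|.
Proof.
move=> downQ; rewrite /chain_weight.
rewrite (exchange_big_dep
  (fun C => [&& is_chain C, \bot%O \in C & C \subset Q])) /=.
  apply: eq_bigr => C /and3P[cC bC sCQ].
  have [|m mC mmax] := chain_max cC; first by apply/set0Pn; exists \bot%O.
  rewrite (big_pred1 m) // => x; rewrite /chain_to cC bC /=.
  apply/and3P/eqP => [[Qx xC /forall_inP xmax]|->].
    by apply/eqP; rewrite eq_le mmax // xmax.
  by split=> //; [exact: (subsetP sCQ) | apply/forall_inP].
move=> x C Qx /and4P[-> -> xC /forall_inP xmax] /=.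
by apply/subsetP=> y /xmax/downQ; apply.
Qed.

Lemma chain_weight_bot : chain_weight \bot%O = t.
Proof.
rewrite /chain_weight (big_pred1 [set \bot%O]) ?cards1 // => C.
apply/and4P/eqP => [[_ bC _ /forall_inP H]|->].
  apply/eqP; rewrite eqEsubset sub1set bC andbT.
  by apply/subsetP=> y /H; rewrite lex0 inE.
split; rewrite ?set11 //.
  by apply/is_chainP=> a b /set1P-> /set1P->; apply: comparablexx.
by apply/forall_inP=> y /set1P->.
Qed.

(** Remove the greatest element [x]. *)
Lemma chain_weightS x : x != \bot%O ->
  chain_weight x = t * \sum_(y | (y < x)%O) chain_weight y.
Proof.
move=> x0; rewrite sum_chain_weight; last by move=> y z; apply: le_lt_trans.
rewrite big_distrr /= /chain_weight.
rewrite (reindex_onto (fun C => x |: C) (fun C => C :\ x)) /=; last first.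
  by move=> C /and4P[_ _ xC _]; rewrite setD1K.
have E C : chain_to x (x |: C) && ((x |: C) :\ x == C) =
           [&& is_chain C, \bot%O \in C & C \subset [pred y | (y < x)%O]].
  apply/andP/and3P.
    case=> /and4P[cC bC _ /forall_inP H] /eqP e.
    have xC : x \notin C by rewrite -e !inE eqxx.
    split; first by apply: is_chainS cC; apply: subsetUr.
      by move: bC; rewrite in_setU1 eq_sym (negPf x0).
    apply/subsetP=> y yC; rewrite inE lt_neqAle H ?inE ?yC ?orbT // andbT.
    by apply: contraNneq xC => <-.
  case=> cC bC /subsetP sC.
  have xC : x \notin C by apply/negP=> /sC; rewrite inE ltxx.
  split; last by rewrite setU1K.
  apply/and4P; split; rewrite ?setU11 ?inE ?bC ?orbT //.
    apply: is_chainU1 => // c /sC; rewrite inE => /ltW.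
    exact: ge_comparable.
  by apply/forall_inP=> y /setU1P[->//|/sC]; rewrite inE => /ltW.
rewrite (eq_bigl _ _ E); apply: eq_bigr => C /and3P[_ _ /subsetP sC].
rewrite cardsU1 (_ : x \notin C) ?exprS //.
by apply/negP=> /sC; rewrite inE ltxx.
Qed.

Lemma chain_polynomialE :
  (chain_polynomial F P).[t] = \sum_(C : {set P} | is_chain C) t ^+ #|C|.
Proof.
rewrite /chain_polynomial horner_sum.
rewrite [RHS](partition_big (fun C => inord #|C| : 'I_(#|P|.+1)) predT) //=.
apply: eq_bigr => k _; rewrite hornerZ hornerXn /num_chains.
have E C : (inord #|C| == k :> 'I_(#|P|.+1)) = (#|C| == k :> nat).
  by rewrite -val_eqE /= inordK // ltnS max_card.
rewrite (eq_bigl [in [set C : {set P} | is_chain C & #|C| == k]]); last first.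
  by move=> C; rewrite inE E.
rewrite (eq_bigr (fun=> t ^+ k)) => [|C]; last first.
  by rewrite inE => /andP[_ /eqP->].
by rewrite sumr_const mulr_natl.
Qed.

(** Adding the bottom element maps the chains avoiding it bijectively to those
    through it. *)
Lemma chain_polynomial_weight :
  t * (chain_polynomial F P).[t] = (1 + t) * \sum_x chain_weight x.
Proof.
rewrite chain_polynomialE (sum_chain_weight (Q := predT)) //.
rewrite (bigID (fun C : {set P} => \bot%O \in C)) /= mulrDr addrC mulrDl mul1r.
congr (_ + _); last first.
  by congr (_ * _); apply: eq_bigl => C; rewrite subset_predT andbT.
rewrite [RHS](reindex_onto (fun C => \bot%O |: C)
                           (fun C => C :\ \bot%O)) /=; last first.
  by move=> C /and3P[_ bC _]; rewrite setD1K.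
rewrite big_distrr /=; apply: eq_big => [C|C /andP[_ bC]]; last first.
  by rewrite cardsU1 bC exprS.
rewrite subset_predT setU11 /= andbT.
apply/andP/andP => [[cC bC]|[cC /eqP <-]].
  split; last by rewrite setU1K.
  by apply: is_chainU1 => // c _; apply: le_comparable; apply: le0x.
split; last by rewrite !inE eqxx.
by apply: is_chainS cC; apply: subD1set.
Qed.

End ChainWeights.

(** * Sums of weights over the elements with a given join *)

Section JoinWeights.
Context {d : Order.disp_t} {L : finTBLatticeType d}.
Hypothesis tri : triangular L.
Context {F : comNzRingType} (t : F).
Implicit Types u v x y z : L.
Local Open Scope ring_scope.

Let gr := tri.1.
Local Notation W := (chain_weight t).

Definition join_weight u x : F := \sum_(y | (y `|` u)%O == x) W y.

(** Induction on the rank through [chain_weightS]. *)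
Lemma chain_weight_rank x x' : rank x = rank x' -> W x = W x'.
Proof.
move: {2}(rank x).+1 (ltnSn (rank x)) => n.
elim: n x x' => // n IH x x' xn e.
have [x0|x0] := eqVneq x \bot%O.
  by congr W; rewrite x0; apply: (eq_rank gr) => //; rewrite -e x0.
have x0' : x' != \bot%O.
  apply: contra_neq x0 => x0'; symmetry.
  by apply: (eq_rank gr) => //; rewrite e x0'.
rewrite !chain_weightS //; congr (_ * _).
have E z : (fun y => (y < z)%O) =1
           (fun y => (\bot <= y <= z)%O && (rank y < rank z)%N).
  move=> y; rewrite le0x /=; apply/idP/andP => [yz|[]].
    by rewrite ltW // rank_lt.
  by rewrite le_eqVlt => /orP[/eqP->|//]; rewrite ltnn.
rewrite (eq_bigl _ _ (E x)) (eq_bigl _ _ (E x')) -e.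
apply: (sum_rank tri (Q := fun k => (k < rank x)%N)) => // z z' _ _ ezz zx.
by apply: IH => //; apply: leq_trans zx _.
Qed.

(** Sort the elements below [x] by their join with [u]. *)
Lemma sum_join_weight u x :
  \sum_(z | (u <= z <= x)%O) join_weight u z =
  if (u <= x)%O then \sum_(y | (y <= x)%O) W y else 0.
Proof.
case: ifP => ux; last first.
  rewrite big1 // => z /andP[uz zx]; have := le_trans uz zx; by rewrite ux.
rewrite [RHS](partition_big (fun y => (y `|` u)%O) (fun z => (u <= z <= x)%O)).
  apply: eq_bigr => z /andP[uz zx]; apply: eq_bigl => y.
  apply/idP/idP => [/eqP e|/andP[]//]; rewrite e eqxx andbT.
  by apply: le_trans zx; rewrite -e leUl.
by move=> y yx; rewrite leUr leUx yx ux.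
Qed.

(** By [sum_join_weight], [join_weight u x] is a sum of weights less the
    [join_weight u z] with [z < x], which are known to depend on ranks only by
    induction on the rank of [x]. *)
Lemma join_weight_rank u x u' x' : (u <= x)%O -> (u' <= x')%O ->
  rank u = rank u' -> rank x = rank x' -> join_weight u x = join_weight u' x'.
Proof.
move: {2}(rank x).+1 (ltnSn (rank x)) => n.
elim: n x x' => // n IH x x' xn ux ux' eu ex.
have E v y : (v <= y)%O -> join_weight v y =
    \sum_(z | (\bot <= z <= y)%O && predT (rank z)) W z
    - \sum_(z | (v <= z <= y)%O && (rank z < rank y)%N) join_weight v z.
  move=> vy; rewrite (eq_bigl (fun z => (z <= y)%O)); last first.
    by move=> z; rewrite le0x andbT.
  have := sum_join_weight v y; rewrite vy => <-.
  rewrite (bigID (fun z => (rank z < rank y)%N)) /= addrC addrK.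
  rewrite (big_pred1 y) // => z; apply/andP/eqP => [[/andP[vz zy]]|->].
    rewrite -leqNgt => h; apply: (eq_rank gr zy); apply/eqP.
    by rewrite eqn_leq h rank_le.
  by rewrite vy lexx ltnn.
rewrite (E _ _ ux) (E _ _ ux') -ex; congr (_ - _).
  by apply: (sum_rank tri) => // z z' _ _ ezz _; apply: chain_weight_rank.
apply: (sum_rank tri (Q := fun k => (k < rank x)%N)) => //.
move=> z z' /andP[uz _] /andP[uz' _] ezz zx.
by apply: IH => //; apply: leq_trans zx _.
Qed.

Lemma join_weight0 x : join_weight \bot%O x = W x.
Proof. by rewrite /join_weight (big_pred1 x) // => y; rewrite joinx0. Qed.

Lemma join_weight_diag x : join_weight x x = \sum_(y | (y <= x)%O) W y.
Proof.
by apply: eq_bigl => y; rewrite -leEjoin.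
Qed.

Lemma join_weight_diag0 x : x != \bot%O ->
  t * join_weight x x = (1 + t) * join_weight \bot%O x.
Proof.
move=> x0; rewrite join_weight0 join_weight_diag (bigD1 x) //=.
rewrite (eq_bigl (fun y => (y < x)%O)) => [|y]; last by rewrite lt_neqAle andbC.
by rewrite mulrDr -chain_weightS // mulrDl mul1r addrC.
Qed.

Hypothesis semi : semimodular L.

(** The meet of [x] and [v] is above [u], so it has at least the rank of [u]
    in the semimodular inequality. *)
Lemma rank_join_cover u v x : (u <= v)%O -> rank v = (rank u).+1 ->
  (u <= x)%O -> (rank (x `|` v)%O <= (rank x).+1)%N.
Proof.
move=> uv rv ux; have := semi.2 x v; rewrite rv.
have : (rank u <= rank (x `&` v)%O)%N by apply: rank_le; rewrite // lexI ux.
lia.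
Qed.

(** The elements [y] whose join with [v] is [x] either have join [x] with [u]
    too, or are sorted by their join [z] with [u]; then [x], which is the join
    of [z] and [v], covers [z] by [rank_join_cover]. *)
Lemma join_weight_step u v x : (u <= v)%O -> rank v = (rank u).+1 ->
  (v <= x)%O ->
  join_weight v x = join_weight u x +
    \sum_(z | [&& (u <= z <= x)%O, (rank z).+1 == rank x & ~~ (v <= z)%O])
       join_weight u z.
Proof.
move=> uv rv vx; rewrite /join_weight (bigID (fun y => (y `|` u)%O == x)) /=.
congr (_ + _).
  apply: eq_bigl => y; apply: andb_idl => /eqP e.
  rewrite eq_le leUx vx andbT -{1}e leUl /=.
  by rewrite -{1}e leUx leUl (le_trans uv) ?leUr.
rewrite (partition_big (fun y => (y `|` u)%O)
  (fun z => [&& (u <= z <= x)%O, (rank z).+1 == rank x & ~~ (v <= z)%O])) /=.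
  apply: eq_bigr => z /and3P[/andP[uz zx] /eqP rz vz].
  apply: eq_bigl => y; apply: andb_idl => /eqP e; apply/andP; split.
    have -> : (y `|` v = z `|` v)%O by rewrite -e -joinA (join_r uv).
    apply/eqP; apply: (eq_rank gr); first by rewrite leUx zx.
    apply/eqP; rewrite eqn_leq rank_le ?leUx ?zx // -rz.
    apply: (rank_lt gr); rewrite lt_neqAle leUl andbT.
    by apply: contra vz => /eqP->; rewrite leUr.
  by rewrite e; apply/eqP => ezx; move: rz; rewrite ezx; lia.
move=> y /andP[/eqP yv yu].
have zv : (y `|` u `|` v = x)%O by rewrite -joinA (join_r uv).
have zx : (y `|` u <= x)%O by rewrite -zv leUl.
rewrite leUr zx /=; apply/andP; split; last first.
  apply: contra yu => vz; rewrite eq_le zx -{1}yv leUx leUl vz.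
  by rewrite !andbT.
rewrite eqn_leq; apply/andP; split.
  by apply: (rank_lt gr); rewrite lt_neqAle yu zx.
by rewrite -{1}zv; apply: (rank_join_cover uv rv); apply: leUr.
Qed.

End JoinWeights.

(** * The triangular array along a maximal chain *)

Section Array.
Context {d : Order.disp_t} {L : finTBLatticeType d}.
Hypothesis tri : triangular L.
Hypothesis semi : semimodular L.
Context {F : comNzRingType} (t : F).
Local Open Scope ring_scope.
Let gr := tri.1.

Lemma saturated_chain : exists X : nat -> L,
  (forall k, (k <= rank (\top%O : L))%N -> rank (X k) = k) /\
  (forall k l, (k <= l <= rank (\top%O : L))%N -> (X k <= X l)%O).
Proof.
have [C HC] := max_chain_exists (closed_itv \bot%O (\top%O : L)).
have ex k : exists z, (k <= rank (\top%O : L))%N ==> (z \in C) && (rank z == k).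
  have [kN|kN] := leqP k (rank (\top%O : L)); last by exists \bot%O.
  have [|z zC rz] := max_chain_rank gr (le0x _) HC (k := k).
    by rewrite rank_bot kN.
  by exists z; rewrite zC rz eqxx.
pose X k := xchoose (ex k); exists X.
have XP k : (k <= rank (\top%O : L))%N -> X k \in C /\ rank (X k) = k.
  by move=> kN; have /implyP/(_ kN)/andP[? /eqP] := xchooseP (ex k).
split=> [k /XP[]//|k l /andP[kl lN]].
have [kC rk] := XP k (leq_trans kl lN); have [lC rl] := XP l lN.
have [_ cC _] := max_chain_inP _ _ HC.
case/orP: (is_chainP _ cC _ _ kC lC) => // lk.
rewrite (eq_rank gr lk) // rk rl; apply/eqP; rewrite eqn_leq kl andbT.
by rewrite -rl -[X in (_ <= X)%N]rk rank_le.
Qed.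

(** Here [f n j] is [join_weight t (X j) (X n)] for a maximal chain [X] of [L],
    and [lambda n j] counts the coatoms of the interval from [X j] to [X n.+1]
    that are not above [X j.+1]; for [j = n] the coatom [X n] is one. *)
Lemma chain_array : exists (N : nat) (lambda : nat -> nat -> nat)
    (f : nat -> nat -> F),
  [/\ f 0 0 = t,
      forall n, (n < N)%N -> (0 < lambda n n)%N,
      forall n j, (n < N)%N -> (j <= n)%N ->
        f n.+1 j.+1 = f n.+1 j + f n j *+ lambda n j,
      forall n, (0 < n <= N)%N -> t * f n n = (1 + t) * f n 0
    & t * (chain_polynomial F L).[t] = (1 + t) * f N N].
Proof.
have [X [rX leX]] := saturated_chain.
set N := rank _ in rX leX.
have X0 : X 0 = \bot%O.
  by symmetry; apply: (eq_rank gr) => //; rewrite rX // rank_bot.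
have XN : X N = \top%O by apply: (eq_rank gr) => //; rewrite rX.
pose Z n j := [pred z : L | [&& (X j <= z <= X n.+1)%O,
  (rank z).+1 == rank (X n.+1) & ~~ (X j.+1 <= z)%O]].
exists N, (fun n j => #|Z n j|), (fun n j => join_weight t (X j) (X n)).
split.
- by rewrite X0 join_weight0 chain_weight_bot.
- move=> n nN; apply/card_gt0P; exists (X n); rewrite inE lexx /=.
  rewrite leX ?leqnSn //= !rX ?eqxx //= 1?ltnW //.
  by apply/negP=> /(rank_le gr); rewrite !rX ?ltnn // ltnW.
- move=> n j nN jn.
  have jN : (j < N)%N by apply: leq_ltn_trans nN.
  rewrite (join_weight_step tri t semi (u := X j)).
  - congr (_ + _); rewrite -sumr_const.
    apply: eq_big => z; first by rewrite inE rX.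
    rewrite rX // => /and3P[/andP[jz _] /eqP[rz] _].
    apply: (join_weight_rank tri);
      by rewrite ?leX ?jn ?rX ?(ltnW jN) ?(ltnW nN).
  - by apply: leX; rewrite leqnSn.
  - by rewrite !rX // ltnW.
  - by apply: leX; rewrite ltnS jn.
- move=> n /andP[n0 nN]; rewrite X0; apply: join_weight_diag0.
  by apply: contraTneq n0 => e; rewrite -(rX n) // e rank_bot.
- rewrite chain_polynomial_weight XN join_weight_diag.
  by congr (_ * _); apply: eq_bigl => y; rewrite lex1.
Qed.
End Array.

(** * Directions of complex numbers *)

Section Cross.
Context {R : rcfType}.
Implicit Types (a b x A B D : R[i]%C).
Local Open Scope ring_scope.

(** The imaginary part of [b] times the conjugate of [a]; for an angle less than
    a half-turn, it is nonnegative when [b] is counterclockwise from [a]. *)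
Definition cross a b : R :=
  complex.Re a * complex.Im b - complex.Im a * complex.Re b.

Definition sqnorm a : R := complex.Re a ^+ 2 + complex.Im a ^+ 2.

Lemma sqnorm_ge0 a : 0 <= sqnorm a.
Proof. by rewrite addr_ge0 ?sqr_ge0. Qed.

Lemma sqnorm_gt0 a : a != 0 -> 0 < sqnorm a.
Proof.
move=> a0; rewrite lt_def sqnorm_ge0 andbT; apply: contra a0.
rewrite paddr_eq0 ?sqr_ge0 // !sqrf_eq0.
by case: a => r i /= /andP[/eqP-> /eqP->].
Qed.

Lemma cross_mulr a x : cross a (x * a) = complex.Im x * sqnorm a.
Proof. by case: a x => a1 a2 [x1 x2]; rewrite /cross /sqnorm /=; ring. Qed.

Lemma crossxx a : cross a a = 0.
Proof. by rewrite /cross; ring. Qed.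

Lemma crossDl b : {morph cross^~ b : u v / u + v}.
Proof. by move=> [u1 u2] [v1 v2]; rewrite /cross /=; ring. Qed.

Lemma crossDr a x : {morph (fun v => cross a (x * v)) : u v / u + v}.
Proof.
by case: a x => a1 a2 [x1 x2] [u1 u2] [v1 v2]; rewrite /cross /=; ring.
Qed.

Lemma additive_sum_ge0 (V : zmodType) (W : numDomainType) (phi : V -> W)
    m n (f : nat -> V) (l : nat -> nat) :
  {morph phi : u v / u + v} ->
  (forall k, (m <= k < n)%N -> 0 <= phi (f k)) ->
  0 <= phi (\sum_(m <= k < n) f k *+ l k).
Proof.
move=> phiD phif.
have phi0 : phi 0 = 0 by apply: (addrI (phi 0)); rewrite -phiD !addr0.
rewrite big_nat; elim/big_rec: _ => [|k s mkn s0]; first by rewrite phi0.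
rewrite phiD addr_ge0 //; elim: (l k) => [|i IH]; first by rewrite phi0.
by rewrite mulrS phiD addr_ge0 ?phif.
Qed.

Lemma cross_sum_ge0 x m n m' n' (f : nat -> R[i]%C) (l : nat -> nat) :
  (forall i j, (m <= i < n)%N -> (m' <= j < n')%N ->
     0 <= cross (f i) (x * f j)) ->
  0 <= cross (\sum_(m <= k < n) f k *+ l k)
             (x * \sum_(m' <= k < n') f k *+ l k).
Proof.
move=> H.
apply: (additive_sum_ge0 l (crossDl _)) => i mi.
apply: (additive_sum_ge0 l (crossDr _ _)) => j mj.
exact: H.
Qed.

(** In this lemma and the next, [A], [D] and [B] stand for partial sums, over
    successive index ranges, of multiples of the entries of a row. Two entries
    of the next row are, up to a common factor, [A + x * (D + B)] and
    [A + D + x * B]. The terms of their [cross] in [A] and [B] alone cancel. *)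
Lemma cross_step_left x A D B : 0 <= complex.Im x ->
  0 <= cross D A -> 0 <= cross B D ->
  0 <= cross A (x * D) -> 0 <= cross D (x * B) ->
  0 <= cross (A + D + x * B) (A + x * (D + B)).
Proof.
move=> x0 DA BD AxD DxB.
have -> : cross (A + D + x * B) (A + x * (D + B)) =
  cross D A + cross A (x * D) + complex.Im x * sqnorm D + cross D (x * B)
  + sqnorm x * cross B D.
  case: x A D B {x0 DA BD AxD DxB} => x1 x2 [a1 a2] [d1 d2] [b1 b2].
  by rewrite /cross /sqnorm /=; ring.
have D0 : 0 <= complex.Im x * sqnorm D by rewrite mulr_ge0 ?sqnorm_ge0.
have xBD : 0 <= sqnorm x * cross B D by rewrite mulr_ge0 ?sqnorm_ge0.
lra.
Qed.

(** The only terms without a sign of their own are those in [A] and [x * B];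
    they complete [sqnorm A] and [sqnorm (x * B)] to
    [sqnorm (A + x * B)]. *)
Lemma cross_step_right x A D B : 0 <= complex.Im x ->
  0 <= cross D A -> 0 <= cross B D ->
  0 <= cross A (x * D) -> 0 <= cross D (x * B) ->
  0 <= cross (A + x * (D + B)) (x * (A + D + x * B)).
Proof.
move=> x0 DA BD AxD DxB.
have -> : cross (A + x * (D + B)) (x * (A + D + x * B)) =
  complex.Im x * sqnorm (A + x * B) + cross A (x * D)
  + sqnorm x * (cross D A + cross D (x * B) + cross B D).
  case: x A D B {x0 DA BD AxD DxB} => x1 x2 [a1 a2] [d1 d2] [b1 b2].
  by rewrite /cross /sqnorm /=; ring.
have AB0 : 0 <= complex.Im x * sqnorm (A + x * B).
  by rewrite mulr_ge0 ?sqnorm_ge0.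
have x2 : 0 <= sqnorm x * (cross D A + cross D (x * B) + cross B D).
  by apply: mulr_ge0; [exact: sqnorm_ge0 | lra].
lra.
Qed.

(** If [A = - x * B] then [cross B A = - complex.Im x * sqnorm B], whose sign
    forces [B = 0], hence also [A = 0]. *)
Lemma cross_step_neq0 x A B : 0 < complex.Im x -> 0 <= cross B A ->
  A + B != 0 -> A + x * B != 0.
Proof.
move=> x0 BA; apply: contra_neq => /eqP; rewrite addr_eq0 => /eqP eA.
suff B0 : B = 0 by rewrite eA B0 mulr0 oppr0 addr0.
apply/eqP/negP => /negP/sqnorm_gt0 B0.
have : 0 < complex.Im x * sqnorm B by rewrite mulr_gt0.
suff -> : complex.Im x * sqnorm B = - cross B A by rewrite oppr_gt0 ltNge BA.
by rewrite eA -cross_mulr; case: B x {B0 BA x0 eA} => b1 b2 [x1 x2];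
   rewrite /cross /=; ring.
Qed.

(** As [j] grows, [f j] turns clockwise, but never past the direction of
    [f i / x] for an earlier [f i]. This is the pointwise form, at a point of
    the upper half-plane, of an interlacing sequence of polynomials. *)
Definition fan x n (f : nat -> R[i]%C) : Prop :=
  (forall j, (j <= n)%N -> f j != 0) /\
  (forall i j, (i <= j <= n)%N ->
     0 <= cross (f j) (f i) /\ 0 <= cross (f i) (x * f j)).

Lemma cross_scale c a b : cross (c * a) (c * b) = sqnorm c * cross a b.
Proof.
by case: a b c => a1 a2 [b1 b2] [c1 c2]; rewrite /cross /sqnorm /=; ring.
Qed.

Lemma fan_step x c n f (l : nat -> nat) : 0 < complex.Im x -> c != 0 ->
  (0 < l n)%N -> fan x n f ->
  fan x n.+1 (fun j => c * (\sum_(0 <= k < j) f k *+ l k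
                            + x * \sum_(j <= k < n.+1) f k *+ l k)).
Proof.
move=> x0 c0 ln [f0 ff].
pose S i j := \sum_(i <= k < j) f k *+ l k.
have SS i j k : (i <= j <= k)%N -> S i k = S i j + S j k.
  by case/andP=> ij jk; apply: big_cat_nat.
have C1 i j k m : (j <= k)%N -> (m <= n.+1)%N -> 0 <= cross (S k m) (S i j).
  move=> jk kn; rewrite -[S i j]mul1r; apply: cross_sum_ge0 => a b.
  move=> /andP[ka am] /andP[ib bj]; rewrite mul1r.
  by have [] := ff b a; first by lia.
have C2 i j k m : (j <= k)%N -> (m <= n.+1)%N -> 0 <= cross (S i j) (x * S k m).
  move=> jk kn; apply: cross_sum_ge0 => a b.
  move=> /andP[ka am] /andP[ib bj].
  by have [] := ff a b; first by lia.
(* All terms are on the same closed side of the line through [x * f n], and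
   the last one is off this line. *)
have S0 : S 0 n.+1 != 0.
  have : 0 < cross (S 0 n.+1) (x * f n).
    rewrite /S big_nat_recr //= crossDl ltr_wpDl //.
      apply: (additive_sum_ge0 l (crossDl _)) => k /andP[_ kn].
      by have [] := ff k n; first by lia.
    have lp : 0 < complex.Im x * sqnorm (f n).
      by rewrite mulr_gt0 ?sqnorm_gt0 ?f0.
    case: (l n) ln => // m _; rewrite mulrS crossDl cross_mulr ltr_pwDl //.
    elim: m => [|m IH]; first by rewrite /cross /= !mul0r subr0.
    by rewrite mulrS crossDl addr_ge0 // cross_mulr ltW.
  by apply: contraTneq => ->; rewrite /cross /= !mul0r subr0 ltxx.
split=> [j jn|i j /andP[ij jn]].
  rewrite mulf_neq0 //; apply: cross_step_neq0 => //; first exact: C1.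
  by rewrite -/(S _ _) -/(S _ _) -SS ?jn.
rewrite -!/(S _ _) (SS 0 i j) ?ij // (SS i j n.+1) ?ij //.
have -> : x * (c * (S 0 i + S i j + x * S j n.+1)) =
  c * (x * (S 0 i + S i j + x * S j n.+1)) by ring.
rewrite !cross_scale; split; apply: mulr_ge0; rewrite ?sqnorm_ge0 //.
  by apply: cross_step_left; first [exact: ltW|exact: C1|exact: C2].
by apply: cross_step_right; first [exact: ltW|exact: C1|exact: C2].
Qed.

End Cross.

(** * Zeros of the diagonal of the array *)

Section RootLocation.
Local Open Scope ring_scope.

(** The step relation gives [f n.+1 j] from [f n.+1 0], and the diagonal
    relation at [n.+1] then determines [f n.+1 0]. *)
Lemma array_rowE (F : comNzRingType) (t : F) (N : nat)
    (lambda : nat -> nat -> nat) (f : nat -> nat -> F) :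
  (forall n j, (n < N)%N -> (j <= n)%N ->
        f n.+1 j.+1 = f n.+1 j + f n j *+ lambda n j) ->
  (forall n, (0 < n <= N)%N -> t * f n n = (1 + t) * f n 0) ->
  forall n j, (n < N)%N -> (j <= n.+1)%N ->
   f n.+1 j = (1 + t) * (\sum_(0 <= k < j) f n k *+ lambda n k)
               + t * (\sum_(j <= k < n.+1) f n k *+ lambda n k).
Proof.
move=> fS fd n j nN jn.
have E i : (i <= n.+1)%N ->
    f n.+1 i = f n.+1 0 + \sum_(0 <= k < i) f n k *+ lambda n k.
  elim: i => [|i IH] ile; first by rewrite big_geq ?addr0.
  by rewrite fS // IH 1?ltnW // big_nat_recr //= addrA.
have := fd n.+1 nN; rewrite (E n.+1) // mulrDr mulrDl mul1r addrC.
move/addIr => e; rewrite E // -e.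
by rewrite (big_cat_nat (n := j)) //=; ring.
Qed.

(** Dividing by [1 + z] brings the row operation to the form of [fan_step] with
    [x = z / (1 + z)], whose imaginary part is
    [complex.Im z / sqnorm (1 + z)]. *)
Lemma array_diag_neq0_upper (R : rcfType) (z : R[i]%C) (N : nat)
    (lambda : nat -> nat -> nat) (f : nat -> nat -> R[i]%C) :
  0 < complex.Im z ->
  f 0 0 = z -> (forall n, (n < N)%N -> (0 < lambda n n)%N) ->
  (forall n j, (n < N)%N -> (j <= n.+1)%N ->
   f n.+1 j = (1 + z) * (\sum_(0 <= k < j) f n k *+ lambda n k)
               + z * (\sum_(j <= k < n.+1) f n k *+ lambda n k)) ->
  f N N != 0.
Proof.
move=> z0 f0 l0 fS.
have zn0 : z != 0 by apply: contraTneq z0 => ->; rewrite ltxx.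
have w0 : 1 + z != 0.
  apply: contraTneq z0 => /eqP; rewrite addrC addr_eq0 => /eqP->.
  by rewrite /= oppr0 ltxx.
pose x := z / (1 + z).
have zE : z = (1 + z) * x by rewrite mulrC mulfVK.
have x0 : 0 < complex.Im x.
  have := cross_mulr (1 + z) x; rewrite mulrC -zE.
  have -> : cross (1 + z) z = complex.Im z.
    by case: z {z0 f0 fS zn0 w0 x zE} => a b; rewrite /cross /=; ring.
  by move=> e; move: z0; rewrite e pmulr_lgt0 // sqnorm_gt0.
suff H n : (n <= N)%N -> fan x n (f n) by have [+ _] := H N (leqnn N); apply.
elim: n => [_|n IH nN].
  split=> [[|//] _|i j]; first by rewrite f0.
  move=> ij0; have [-> ->] : i = 0 /\ j = 0 by lia.
  rewrite crossxx cross_mulr; split=> //.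
  by apply: mulr_ge0; [exact: ltW | exact: sqnorm_ge0].
have [H1 H2] := fan_step x0 w0 (l0 n nN) (IH (ltnW nN)).
have E j : (j <= n.+1)%N ->
    f n.+1 j = (1 + z) * (\sum_(0 <= k < j) f n k *+ lambda n k
                          + x * \sum_(j <= k < n.+1) f n k *+ lambda n k).
  by move=> jn; rewrite fS // mulrDr mulrA -zE.
split=> [j jn|i j ijn]; first by rewrite E ?H1.
by have := H2 i j ijn; case/andP: ijn => ij jn; rewrite -!E // (leq_trans ij).
Qed.

(** Outside [[-1, 0]] the ratio [(1 + z) / z] is positive, so up to a factor [z]
    each row is a positive combination of the previous one. *)
Lemma array_diag_neq0_real (R : realFieldType) (z : R) (N : nat)
    (lambda : nat -> nat -> nat) (f : nat -> nat -> R) :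
  ~~ (-1 <= z <= 0) ->
  f 0 0 = z -> (forall n, (n < N)%N -> (0 < lambda n n)%N) ->
  (forall n j, (n < N)%N -> (j <= n.+1)%N ->
   f n.+1 j = (1 + z) * (\sum_(0 <= k < j) f n k *+ lambda n k)
               + z * (\sum_(j <= k < n.+1) f n k *+ lambda n k)) ->
  f N N != 0.
Proof.
move=> zout f0 l0 fS.
have zn0 : z != 0.
  by apply: contraNneq zout => ->; rewrite lexx lerN10.
have p0 : 0 < (1 + z) / z.
  have [zp|zn] := ltrP 0 z; first by rewrite divr_gt0 // ltr_pwDl // ltW.
  have zn' : z < 0 by rewrite lt_neqAle zn0.
  rewrite ltr_ndivlMr // mul0r; move: zout; rewrite zn andbT -ltNge; lra.
suff H n : (n <= N)%N -> exists c, forall j, (j <= n)%N -> 0 < c * f n j.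
  have [c /(_ N (leqnn N))] := H N (leqnn N).
  by apply: contraTneq => ->; rewrite mulr0 ltxx.
elim: n => [_|n IH nN].
  exists z^-1 => -[|//] _; by rewrite f0 mulVf.
have [c cf] := IH (ltnW nN); exists (c / z) => j jn.
rewrite fS //; set A := \sum_(0 <= k < j) _; set B := \sum_(j <= k < n.+1) _.
have -> : c / z * ((1 + z) * A + z * B) = (1 + z) / z * (c * A) + c * B.
  by field.
have cge a b : (b <= n.+1)%N -> 0 <= c * \sum_(a <= k < b) f n k *+ lambda n k.
  move=> bn; apply: (@additive_sum_ge0 _ _ (fun v => c * v)).
    by move=> u v; rewrite mulrDr.
  by move=> k /andP[_ kb]; rewrite ltW // cf // -ltnS (leq_trans kb).
have A0 : 0 <= c * A by apply: cge.
have B0 : 0 <= c * B by apply: cge.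
have S0 : 0 < c * A + c * B.
  rewrite -mulrDr -big_cat_nat //= big_nat_recr //= mulrDr ltr_wpDl ?cge //.
  by rewrite mulrnAr pmulrn_lgt0 ?l0 ?cf.
have [A0'|A0'] := ltrP 0 (c * A); first by rewrite ltr_pwDl // mulr_gt0.
have cA : c * A = 0 by apply: le_anti; rewrite A0' A0.
by rewrite cA mulr0 add0r; move: S0; rewrite cA add0r.
Qed.

End RootLocation.

(** * The theorem *)

Theorem corollary3p8 (R : realType) (d : Order.disp_t)
    (L : finTBLatticeType d) (hs : semimodular L) (ht : triangular L) :
  real_rooted (chain_polynomial R L) /\
  (forall x : R, root (chain_polynomial R L) x -> (-1 <= x <= 0)%R).
Proof.
pose q := map_poly (real_complex R) (chain_polynomial R L).
have qE : q = chain_polynomial R[i]%C L.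
  rewrite /q /chain_polynomial rmorph_sum; apply: eq_bigr => k _ /=.
  by rewrite map_polyZ map_polyXn rmorph_nat.
have upper z : (0 < complex.Im z)%R -> ~~ root q z.
  move=> z0; rewrite qE.
  have [N [lambda [f [f0 l0 fS fd fN]]]] := chain_array ht hs z.
  have := array_diag_neq0_upper z0 f0 l0 (array_rowE fS fd).
  apply: contra => /eqP r0; move: fN; rewrite r0 mulr0 => /esym/eqP.
  rewrite mulf_eq0 => /orP[/eqP w0|//].
  move: z0; have -> : z = (-1)%R.
    by apply/eqP; rewrite -subr_eq0 opprK addrC w0.
  by rewrite /= oppr0 ltxx.
split=> [z rz|x].
- have qconj : map_poly (@conjc R) q = q.
    rewrite qE /chain_polynomial rmorph_sum; apply: eq_bigr => k _ /=.
    by rewrite map_polyZ map_polyXn rmorph_nat.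
  (* The coefficients are real: nonreal zeros come in conjugate pairs. *)
  case: (ltgtP (complex.Im z) 0%R) => zi.
  + have : ~~ root q (conjc z).
      by apply: upper; case: z zi {rz} => a b /=; rewrite oppr_gt0.
    by rewrite -complex_root_conj qconj rz.
  + by have := upper _ zi; rewrite rz.
  + by exists (complex.Re z); case: z zi {rz} => a b /= ->.
- apply: contraTT => xout.
  have [N [lambda [f [f0 l0 fS fd fN]]]] := chain_array ht hs x.
  have := array_diag_neq0_real xout f0 l0 (array_rowE fS fd).
  apply: contra => /eqP r0; move: fN; rewrite r0 mulr0 => /esym/eqP.
  rewrite mulf_eq0 => /orP[/eqP w0|//].
  case/negP: xout; have -> : x = (-1)%R.
    by apply/eqP; rewrite -subr_eq0 opprK addrC w0.
  by rewrite lexx lerN10.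
Qed.
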